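(* Let $1\le n\le N$, $1\le m\le N$ be integers and let $\varepsilon\in(0,1)$. Suppose $u(q)$ is measurable. Then $$P\{P\{u(q)>\hat u_n\}\le\varepsilon\}\;\ge\;1-\int_0^{1-\varepsilon}\frac{N!}{(n-1)!\,(N-n)!}\,x^{n-1}(1-x)^{N-n}\,dx,$$ and equality holds if and only if $\sup_{\{x:\,F_u(x)<1-\varepsilon\}}F_u(x)=1-\varepsilon$. Moreover, $$P\{P\{u(q)<\hat u_m\}\le\varepsilon\}\;\ge\;1-\int_0^{1-\varepsilon}\frac{N!}{(m-1)!\,(N-m)!}\,x^{N-m}(1-x)^{m-1}\,dx,$$ and equality holds if and only if $\inf_{\{x:\,F_u(x)>\varepsilon\}}F_u(x)=\varepsilon$.
   Context: Let $q$ be a random vector taking values in a compact set $\mathcal{Q}$, with a multivariate probability density function, and let $u$ be a real-valued measurable function of $q$. Write $F_u(\gamma):=P\{u(q)\le\gamma\}$, $\gamma\in\mathbb{R}$, for the cumulative distribution function of $u(q)$. Let $q^1,\dots,q^N$ be i.i.d. samples with the same distribution as $q$, and let $\hat u_i$ ($1\le i\le N$) be the $i$-th smallest of $u(q^1),\dots,u(q^N)$, so $\hat u_1\le\hat u_2\le\cdots\le\hat u_N$ (order statistics). In the nested probabilities, the inner probability is over $q$ with the value of the order statistic held fixed (i.e. $q$ is independent of the samples), so it is a random variable depending on the samples: $P\{u(q)>\hat u_n\}$ means $1-F_u(\hat u_n)$, and $P\{u(q)<\hat u_m\}$ means the left limit $F_u(\hat u_m^-)$ of $F_u$ at $\hat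 u_m$. The outer probability is over the samples $q^1,\dots,q^N$. *)

(* Defs.v *)
From HB Require Import structures.
From mathcomp Require Import all_boot all_order all_algebra.
From mathcomp Require Import all_classical all_reals all_analysis.

Set Implicit Arguments.
Unset Strict Implicit.
Unset Printing Implicit Defensive.

Import Order.TTheory GRing.Theory Num.Theory.
Import numFieldNormedType.Exports.

Local Open Scope classical_set_scope.
Local Open Scope ring_scope.

(* R^d is represented by [d.-tuple R], which carries in the library the product
   (i.e. Borel) sigma-algebra but no topology; the topology is that of the row
   vectors 'rV[R]_d. *)
Definition compact_tuple (R : realType) (d : nat) (Q : set (d.-tuple R)) : Prop :=
  compact ((fun x => \row_i tnth x i) @` Q : set 'rV[R]_d).

Section lebesgue_tuple.
Context {R : realType}.

Section step.
Variables (n : nat) (m : {sigma_finite_measure set (n.-tuple R) -> \bar R}).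

Definition cons_pair (p : measurableTypeR R * n.-tuple R) : n.+1.-tuple R :=
  [the n.+1.-tuple R of p.1 :: p.2].

Lemma measurable_cons_pair : measurable_fun setT cons_pair.
Proof. exact: measurable_cons. Qed.

Definition lebesgue_cons : set (n.+1.-tuple R) -> \bar R :=
  pushforward (@lebesgue_measure R \x m)%E cons_pair.

Let lebesgue_cons0 : lebesgue_cons set0 = 0%E.
Proof. by rewrite /lebesgue_cons /pushforward preimage_set0 measure0. Qed.

Let lebesgue_cons_ge0 A : (0 <= lebesgue_cons A)%E.
Proof. by rewrite /lebesgue_cons /pushforward; exact: measure_ge0. Qed.

Let lebesgue_cons_sigma_additive : semi_sigma_additive lebesgue_cons.
Proof.
move=> F mF tF mUF.
have mpre A : measurable A -> measurable (cons_pair @^-1` A).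
  by move=> mA; rewrite -[X in measurable X]setTI; exact: measurable_cons_pair.
rewrite /lebesgue_cons /pushforward preimage_bigcup.
apply: measure_semi_sigma_additive.
- by move=> k; exact: mpre.
- apply/trivIsetP => /= i j _ _ ij; rewrite -preimage_setI.
  by move/trivIsetP : tF => /(_ _ _ _ _ ij) ->//; rewrite preimage_set0.
- by rewrite -preimage_bigcup; exact: mpre.
Qed.

HB.instance Definition _ := isMeasure.Build _ _ _ lebesgue_cons
  lebesgue_cons0 lebesgue_cons_ge0 lebesgue_cons_sigma_additive.

Lemma lebesgue_consX (A : set R) (B : set (n.-tuple R)) :
  measurable A -> measurable B ->
  lebesgue_cons [set x | A (thead x) /\ B [tuple of behead x]] =
  (lebesgue_measure A * m B)%E.
Proof.
move=> mA mB; rewrite -(product_measure1E _ m)//.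
suff -> : A `*` B = cons_pair @^-1` [set x | A (thead x) /\ B [tuple of behead x]].
  by [].
have bE (a : R) (t : n.-tuple R) :
    [tuple of behead (cons_pair (a, t))] = t :> n.-tuple R by exact: val_inj.
by apply/seteqP; split=> -[a t] /=; rewrite bE.
Qed.

Let lebesgue_cons_sigma_finite : sigma_finite setT lebesgue_cons.
Proof.
have /sigma_finiteP[F [TF ndF Foo]] := sigma_finiteT (@lebesgue_measure R).
have /sigma_finiteP[G [TG ndG Goo]] := sigma_finiteT m.
exists (fun k => [set x | F k (thead x) /\ G k [tuple of behead x]]).
  apply/esym; rewrite -subTset => x _.
  have [i _ Fi] : (\bigcup_k F k) (thead x) by rewrite -TF.
  have [j _ Gj] : (\bigcup_k G k) [tuple of behead x] by rewrite -TG.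
  exists (maxn i j) => //; split.
  - by move: Fi; exact/subsetPset/ndF/leq_maxl.
  - by move: Gj; exact/subsetPset/ndG/leq_maxr.
move=> k; have [mF Fk] := Foo k; have [mG Gk] := Goo k.
split; last by rewrite lebesgue_consX// lte_mul_pinfty// ge0_fin_numE.
apply: measurableI.
- rewrite -[X in measurable X]setTI.
  exact: (@measurable_tnth _ R n.+1 ord0).
- rewrite -[X in measurable X]setTI; exact: measurable_behead.
Qed.

HB.instance Definition _ := Measure_isSigmaFinite.Build _ _ _ lebesgue_cons
  lebesgue_cons_sigma_finite.

End step.

(* Lebesgue measure on R^d, as an iterated product. *)
Fixpoint lebesgue_tuple (d : nat) :
    {sigma_finite_measure set (d.-tuple R) -> \bar R} :=
  if d is n.+1 then lebesgue_cons (lebesgue_tuple n)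
  else \d_([tuple] : 0.-tuple R).

Lemma lebesgue_tuple_box d (A : 'I_d -> set R) : (forall i, measurable (A i)) ->
  lebesgue_tuple d [set x | forall i, A i (tnth x i)] =
  (\prod_(i < d) lebesgue_measure (A i))%E.
Proof.
elim: d A => [A _|d IH A mA] /=.
  by rewrite big_ord0 diracE mem_set// => -[].
rewrite big_ord_recl -IH => [|i]; last exact: mA.
rewrite -lebesgue_consX; [|exact: mA|].
  congr (_ _); apply/seteqP; split=> x /=.
    move=> h; split=> [|i]; first exact: h.
    by rewrite tnth_behead (_ : inord _ = lift ord0 i)//;
      apply/val_inj; rewrite /= inordK//= ltnS.
  move=> [h0 h] i; case: (unliftP ord0 i) => [j|] -> //.
  have := h j; rewrite tnth_behead (_ : inord _ = lift ord0 j)//.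
  by apply/val_inj; rewrite /= inordK//= ltnS.
rewrite [X in measurable X](_ : _ =
  \bigcap_(i in [set: 'I_d]) ((fun x => tnth x i) @^-1` A (lift ord0 i))).
  apply: fin_bigcap_measurable => // i _; rewrite -[X in measurable X]setTI.
  by apply: measurable_tnth => //; exact: mA.
by apply/seteqP; split=> x /= h i; [move=> _|]; exact: h.
Qed.

End lebesgue_tuple.

Definition has_density (R : realType) (d : nat)
    (mu : set (d.-tuple R) -> \bar R) : Prop :=
  exists f : d.-tuple R -> R,
    [/\ measurable_fun setT f, (forall x, 0 <= f x) &
        forall A, measurable A ->
          mu A = (\int[lebesgue_tuple d]_(x in A) (f x)%:E)%E].

Definition same_distribution (R : realType) (d0 d1 d2 : measure_display)
    (T0 : measurableType d0) (T1 : measurableType d1) (E : measurableType d2)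
    (P0 : probability T0 R) (P1 : probability T1 R)
    (X : {RV P0 >-> E}) (Y : {RV P1 >-> E}) : Prop :=
  forall A, measurable A -> distribution P0 X A = distribution P1 Y A.

Definition mutually_independent (R : realType) (I : finType)
    (d1 d2 : measure_display) (T : measurableType d1) (E : measurableType d2)
    (P : probability T R) (X : I -> {RV P >-> E}) : Prop :=
  forall (J : {set I}) (B : I -> set E), (forall i, measurable (B i)) ->
    P (\bigcap_(i in [set` J]) X i @^-1` B i) =
    (\prod_(i in J) P (X i @^-1` B i))%E.

(* The [i]-th smallest value of the family [x], counted with multiplicity;
   meaningful for 1 <= i <= N. *)
Definition order_stat (R : realType) (N : nat) (x : 'I_N -> R) (i : nat) : R :=
  nth 0 (sort <=%R [seq x j | j <- enum 'I_N]) i.-1.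

(* The library's [cdf], for a function not bundled with a proof of its
   measurability. *)
Definition cdf_fun (R : realType) (d : measure_display) (T : measurableType d)
    (P : probability T R) (X : T -> R) (r : R) : \bar R :=
  P (X @^-1` `]-oo, r]).

(* Main.v *)
(* Both events say that an order statistic falls in a down-closed set L of reals,
   i.e. that at least n of the N samples fall in L. Writing p for the probability
   that u(q) is in L, this is a binomial tail T_n(p), a polynomial whose
   derivative telescopes to the beta density N!/((n-1)!(N-n)!) x^(n-1) (1-x)^(N-n),
   so that T_n(a) is the integral of that density over [0, a] and T_n is strictly
   increasing on [0, 1].
   The first event is the complement of that of L = {F < 1 - eps}, for which p is
   the supremum of F over L, at most 1 - eps; the second one is the event of
   L = {x | F(x-) <= eps}, the set of lower bounds of {F > eps}, for which p is the
   infimum of F over {F > eps}, at least eps. Strict monotonicity of T_n turns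
   both comparisons into the inequalities and their equality cases. The
   second integral becomes T_m(eps) by the symmetry
   1 - T_(N-m+1)(1 - x) = T_m(x). *)

Require Import Defs.
From HB Require Import structures.
From mathcomp Require Import all_boot all_order all_algebra.
From mathcomp Require Import all_classical all_reals all_analysis.
From mathcomp Require Import measurable_realfun ring lra zify.

Set Implicit Arguments.
Unset Strict Implicit.
Unset Printing Implicit Defensive.

Import Order.TTheory GRing.Theory Num.Theory.
Import numFieldNormedType.Exports.

Local Open Scope classical_set_scope.
Local Open Scope ring_scope.

(** * Order statistics and down-closed sets *)

(** The members of a down-closed set form a prefix of a sorted list: if entry [k] is one, so are the
    [k.+1] first entries, and if not, no entry from [k] on is. *)
Lemma sorted_nth_downclosed (R : realDomainType) (L : {pred R}) (s : seq R)
    (k : nat) :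
  (forall x y, x <= y -> y \in L -> x \in L) ->
  sorted <=%R s -> (k < size s)%N ->
  (nth 0 s k \in L) = (k < count [in L] s)%N.
Proof.
move=> dL ss ks; have le_s := sorted_leq_nth le_trans le_refl 0 ss.
apply/idP/idP => [kL|].
  rewrite -(cat_take_drop k.+1 s) count_cat -[X in (X <= _)%N]addn0 leq_add//.
  rewrite (_ : count _ _ = size (take k.+1 s)); first by rewrite size_take_min leq_min leqnn.
  apply/eqP; rewrite -all_count; apply/(all_nthP 0) => i.
  rewrite size_take_min leq_min => /andP[ik iss]; rewrite nth_take//.
  by apply: dL kL; apply: le_s.
apply: contraTT => kL; rewrite -leqNgt -(cat_take_drop k s) count_cat.
rewrite -[X in (_ <= X)%N]addn0 leq_add//.
  by rewrite (leq_trans (count_size _ _))// size_take_min geq_minl.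
rewrite leqn0 -[_ == _]negbK -lt0n -has_count; apply/(has_nthP 0) => -[i].
rewrite size_drop nth_drop => iss; apply/negP.
by apply: contra kL; apply: dL; apply: le_s; rewrite ?leq_addr// inE -ltn_subRL.
Qed.

Lemma order_stat_downclosed (R : realType) (N n : nat) (x : 'I_N -> R)
    (L : {pred R}) :
  (forall x y, x <= y -> y \in L -> x \in L) -> (1 <= n <= N)%N ->
  (order_stat x n \in L) = (n <= #|[pred j | x j \in L]|)%N.
Proof.
move=> dL /andP[n0 nN]; rewrite /order_stat sorted_nth_downclosed//.
- by rewrite prednK// count_sort count_map cardE size_filter -enumT.
- exact/sort_sorted/le_total.
- by rewrite size_sort size_map size_enum_ord prednK.
Qed.

(** * Binomial tails and beta integrals *)

(* The probability of at least n successes in N independent trials, as a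
   polynomial in the success probability. *)
Definition binomial_tail (R : comNzRingType) (N n : nat) : {poly R} :=
  \sum_(n <= k < N.+1) ('X^k * (1 - 'X) ^+ (N - k)) *+ 'C(N, k).

Lemma binomial_tail_deriv (R : comNzRingType) (N n : nat) :
  (1 <= n <= N)%N ->
  (binomial_tail R N n)^`()%R =
  ('X^(n.-1) * (1 - 'X) ^+ (N - n)) *+ (n * 'C(N, n))%N.
Proof.
case: n => // n; case: N => // N /=; rewrite ltnS => nN.
(* With [N.+1] trials after the case split, the product rule and the two binomial identities below
   turn the derivative of term [k] into [g k.-1 - g k]. *)
pose g k : {poly R} := ('X^k * (1 - 'X) ^+ (N - k)) *+ (N.+1 * 'C(N, k)).
rewrite /binomial_tail raddf_sum/=.
transitivity (\sum_(n.+1 <= k < N.+2) - (g k - g k.-1)).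
  apply: eq_big_nat => -[//|k]; rewrite ltnS => /andP[nk kN].
  rewrite derivMn derivM derivXn deriv_exp derivB derivX (derivC 1) /g /=.
  rewrite subSS sub0r mulrnDl opprB -mulNrn.
  have h1 : (N.+1 * 'C(N, k) = k.+1 * 'C(N.+1, k.+1))%N by rewrite mul_bin_diag.
  have h2 : (N.+1 * 'C(N, k.+1) = (N - k) * 'C(N.+1, k.+1))%N.
    by rewrite -subSS mul_bin_down.
  by rewrite h1 h2 subnS; ring.
(* Only the lower end [g n] survives: the upper end [g N.+1] carries the zero coefficient
   ['C(N, N.+1)]. *)
rewrite sumrN big_add1/= telescope_sumr 1?leqW// opprB /g (@bin_small N N.+1)// muln0 mulr0n subr0/=.
by rewrite mul_bin_diag subSS.
Qed.

Lemma binomial_tail0 (R : comNzRingType) (N n : nat) : (0 < n)%N ->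
  (binomial_tail R N n).[0] = 0.
Proof.
move=> n0; rewrite horner_sum big_nat big1// => k /andP[nk _].
by rewrite hornerMn hornerM hornerXn expr0n gtn_eqF ?mul0r ?mul0rn// (leq_trans n0).
Qed.

(** At least [n] successes means fewer than [(N - n).+1] failures, and failures have probability
    [1 - x]. *)
Lemma binomial_tail_compl (R : comNzRingType) (N n : nat) (x : R) : (n <= N)%N ->
  1 - (binomial_tail R N (N - n).+1).[1 - x] = (binomial_tail R N n).[x].
Proof.
move=> nN; apply/eqP; rewrite subr_eq; apply/eqP.
have sumE k y : (binomial_tail R N k).[y] =
    \sum_(k <= i < N.+1) (y ^+ i * (1 - y) ^+ (N - i)) *+ 'C(N, i).
  rewrite horner_sum; apply: eq_bigr => i _.
  by rewrite hornerMn hornerM hornerXn horner_exp !hornerE.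
(* Expand 1 as the [N]-th power of [(1 - x) + x] and split at index [n]; reversing the indices below
   [n] gives the tail in [1 - x]. *)
rewrite !sumE -[LHS](expr1n _ N) -{1}(subrK x 1) exprDn.
rewrite -(big_mkord xpredT (fun i => ((1 - x) ^+ (N - i) * x ^+ i) *+ 'C(N, i))).
rewrite (@big_cat_nat _ _ _ n)//=; last exact: leqW.
rewrite addrC; congr (_ + _); first by apply: eq_bigr => i _; rewrite mulrC.
rewrite big_nat_rev/= add0n -[X in _ = \sum_(X <= _ < _) _]add0n big_addn.
rewrite subSS subKn//; apply: eq_big_nat => i /andP[_ ni].
have -> : (i + (N - n).+1 = N - (n - i.+1))%N by lia.
by rewrite bin_sub ?subKn ?opprB ?[_ + (x - _)]addrC ?subrK//; lia.
Qed.

Lemma binomial_tail_deriv_fact (R : numFieldType) (N n : nat) :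
  (1 <= n <= N)%N ->
  (n * 'C(N, n))%:R = N`!%:R / (n.-1`!%:R * (N - n)`!%:R) :> R.
Proof.
case: n => // n /andP[_ nN] /=; apply: (canRL (mulfK _)).
  by rewrite mulf_neq0// pnatr_eq0 -lt0n fact_gt0.
by rewrite -!natrM -(bin_fact nN) factS; congr _%:R; lia.
Qed.

Section binomial_tail_real.
Context {R : realType}.
Variables (N n : nat).
Hypothesis nN : (1 <= n <= N)%N.

Let density (x : R) :=
  N`!%:R / (n.-1`!%:R * (N - n)`!%:R) * x ^+ n.-1 * (1 - x) ^+ (N - n).

Let derive1_tail x : (horner (binomial_tail R N n))^`()%classic x = density x.
Proof.
rewrite -derivE binomial_tail_deriv// hornerMn hornerM hornerXn horner_exp.
rewrite !hornerE -mulr_natl (binomial_tail_deriv_fact _ nN) /density.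
by rewrite mulrA.
Qed.

Lemma integral_beta_density (a : R) : 0 < a ->
  (\int[lebesgue_measure]_(x in `[0%R, a])
    (N`!%:R / (n.-1`!%:R * (N - n)`!%:R) * x ^+ n.-1 * (1 - x) ^+ (N - n))%:E)%E
  = ((binomial_tail R N n).[a])%:E.
Proof.
move=> a0; rewrite (@continuous_FTC2 _ density (horner (binomial_tail R N n)))//.
- by rewrite binomial_tail0 ?sube0//; case/andP: nN.
- rewrite (_ : density = horner (binomial_tail R N n)^`()).
    exact/continuous_subspaceT/continuous_horner.
  by apply/funext => x; rewrite derivE derive1_tail.
- split=> [x _| |]; first exact: derivable_horner.
  + exact/cvg_at_right_filter/continuous_horner.
  + exact/cvg_at_left_filter/continuous_horner.
Qed.

Lemma binomial_tail_ltr :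
  {in `[0, 1]%R &, {homo horner (binomial_tail R N n) : x y / x < y}}.
Proof.
apply: gtr0_derive1_lt_cc.
- by move=> x _; exact: derivable_horner.
- move=> x; rewrite in_itv/= => /andP[x0 x1]; rewrite derive1_tail /density.
  rewrite !mulr_gt0 ?invr_gt0 ?mulr_gt0 ?exprn_gt0 ?subr_gt0//;
    by rewrite ltr0n fact_gt0.
- exact/continuous_subspaceT/continuous_horner.
Qed.

End binomial_tail_real.

(** * Counting independent events *)

(** Sorting the outcomes by the exact set [J] of events that occur yields disjoint pieces, whose
    probabilities add up. *)
Lemma count_ge_bigcup (T : Type) (N n : nat) (E : 'I_N -> set T) :
  [set w | (n <= #|[pred i | w \in E i]|)%N] =
  \bigcup_(J in [set J : {set 'I_N} | (n <= #|J|)%N])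
    \bigcap_(i in [set: 'I_N]) if i \in J then E i else ~` E i.
Proof.
apply/seteqP; split=> w /=.
  move=> nw; exists [set i | w \in E i]%SET; first by rewrite /= cardsE.
  by move=> i _; rewrite inE; case: ifPn => [/set_mem//|/negP h /mem_set].
move=> [J /= nJ Jw]; move: nJ; rewrite (_ : #|J| = #|[pred i | w \in E i]|)//.
apply: eq_card => i; rewrite inE/=; have := Jw i Logic.I.
case: ifPn => _ Ew; first by rewrite mem_set.
by rewrite (memNset Ew).
Qed.

Section count_ge.
Context d (T : measurableType d) (R : realType) (P : probability T R).
Variables (N n : nat) (E : 'I_N -> set T).
Hypothesis mE : forall i, measurable (E i).

Let mA (J : {set 'I_N}) :
  measurable (\bigcap_(i in [set: 'I_N]) if i \in J then E i else ~` E i).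
Proof.
apply: fin_bigcap_measurable => // i _; case: ifP => _ //.
exact: measurableC.
Qed.

Lemma measurable_count_ge :
  measurable [set w | (n <= #|[pred i | w \in E i]|)%N].
Proof.
rewrite count_ge_bigcup; exact: fin_bigcup_measurable.
Qed.

Lemma probability_count_ge (p : R) :
  (forall J : {set 'I_N},
    P (\bigcap_(i in [set: 'I_N]) if i \in J then E i else ~` E i) =
    (\prod_(i < N) if i \in J then p else 1 - p)%:E) ->
  P [set w | (n <= #|[pred i | w \in E i]|)%N] = (binomial_tail R N n).[p]%:E.
Proof.
move=> PE; rewrite count_ge_bigcup.
rewrite measure_fin_bigcup//; [|exact: finite_finset|]; last first.
  move=> I J _ _ [w [Iw Jw]]; apply/setP => i.
  have := Iw i Logic.I; have := Jw i Logic.I.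
  by case: (i \in I); case: (i \in J).
transitivity (\sum_(J : {set 'I_N} | (n <= #|J|)%N)
    P (\bigcap_(i in [set: 'I_N]) if i \in J then E i else ~` E i))%E.
  rewrite -(bigfs _ (index_enum_uniq _))//.
  by move=> J _; rewrite mem_index_enum.
rewrite (eq_bigr (fun J : {set 'I_N} =>
    (p ^+ #|J| * (1 - p) ^+ (N - #|J|))%:E)); last first.
  move=> J _; rewrite PE; congr _%:E; rewrite (bigID (mem J))/=; congr (_ * _).
    by rewrite (eq_bigr (fun=> p)) ?prodr_const// => i ->.
  rewrite (eq_bigr (fun=> 1 - p)) => [|i /negbTE ->//].
  rewrite prodr_const; congr (_ ^+ _).
  have : (#|J| + #|~: J| = N)%N by rewrite cardsC card_ord.
  by move/(canRL (addKn _)) <-; apply: eq_card => i; rewrite inE.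
rewrite sumEFin; congr _%:E; rewrite horner_sum.
(* Group the sets [J] by cardinality: each of the ['C(N, k)] sets of size [k] contributes the same
   product. *)
rewrite (partition_big (fun J : {set 'I_N} => inord #|J| : 'I_N.+1)
  (fun k : 'I_N.+1 => (n <= k)%N)) /=; last first.
  by move=> J nJ; rewrite inordK// ltnS -[leqRHS](card_ord N) max_card.
rewrite big_geq_mkord; apply: eq_bigr => k nk.
rewrite hornerMn hornerM hornerXn horner_exp !hornerE.
rewrite (eq_bigl (fun J => J \in [set J : {set 'I_N} | #|J| == k]%SET)); last first.
  move=> J; rewrite inE -val_eqE/= inordK; last first.
    by rewrite ltnS -[leqRHS](card_ord N) max_card.
  by case: eqP => [->|]; rewrite ?andbT ?andbF.
rewrite (eq_bigr (fun=> p ^+ k * (1 - p) ^+ (N - k))) => [|J]; last first.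
  by rewrite inE => /eqP ->.
by rewrite sumr_const card_draws card_ord.
Qed.

End count_ge.

(** * Measurability of closed sets of tuples *)

(* The complement of Q is a union of countably many boxes with rational centers
   and radii 1/(k+1). *)
Lemma closed_rV_measurable (R : realType) (d : nat) (Q : set (d.-tuple R)) :
  closed ((fun x => \row_i tnth x i) @` Q : set 'rV[R]_d) -> measurable Q.
Proof.
move=> cQ; rewrite -[Q]setCK; apply: measurableC.
pose box (ck : d.-tuple rat * nat) : set (d.-tuple R) :=
  \bigcap_(i in [set: 'I_d])
    (fun x => tnth x i) @^-1` (ball (ratr (tnth ck.1 i) : R) ck.2.+1%:R^-1).
have mbox ck : measurable (box ck).
  apply: fin_bigcap_measurable => // i _; rewrite -[X in measurable X]setTI.
  by apply: measurable_tnth => //; exact: measurable_ball.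
(* Boxes that meet [Q] are replaced by the empty set, so that the union runs over a whole countable
   type. *)
pose F ck := if pselect (box ck `<=` ~` Q) then box ck else set0.
suff -> : ~` Q = \bigcup_ck F ck.
  apply: countable_bigcupT_measurable => [|ck]; first exact: countableP.
  by rewrite /F; case: pselect => ?; [exact: mbox|exact: measurable0].
apply/seteqP; split=> [x Qx|x [ck _]]; last first.
  by rewrite /F; case: pselect => //= bQ xb; exact: bQ.
set K := (X in closed X) in cQ.
have rowK (y : d.-tuple R) : K (\row_i tnth y i) -> Q y.
  move=> [z Qz /rowP zy]; suff -> : y = z by [].
  by apply: eq_from_tnth => i; have := zy i; rewrite !mxE => ->.
have : nbhs (\row_i tnth x i) (~` K).
  by apply: open_nbhs_nbhs; split; [exact: closed_openC|move=> /rowK].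
move=> /nbhs_ballP[e /= e0 eK].
(* The factor 2 is for the triangle inequality: [x] and any [y] of the box are each within [1/(k+1)]
   of its center. *)
have [k ke] : exists k : nat, 2 / k.+1%:R < e.
  have e20 : 0 < e / 2 by rewrite divr_gt0.
  have [k _ /(_ k (leqnn k)) /= ke] := near_infty_natSinv_lt (PosNum e20).
  by exists k; rewrite mulrC -ltr_pdivlMr.
have k0 : 0 < k.+1%:R^-1 :> R by rewrite invr_gt0.
have /choice[c cx] : forall i, exists r : rat,
    ball (ratr r : R) k.+1%:R^-1 (tnth x i).
  move=> i; have [|r] := @rat_in_itvoo _ (tnth x i - k.+1%:R^-1) (tnth x i).
    by rewrite ltrBlDr ltrDl.
  rewrite in_itv/= => /andP[r1 r2]; exists r.
  by rewrite /ball/= ltr_distlC; move: k0 r1; set h := _^-1 => *; apply/andP; split; lra.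
exists ([tuple c i | i < d], k) => //.
rewrite /F; case: pselect => [?|[]].
  by move=> i _; rewrite /= tnth_mktuple.
move=> y bxy Qy; apply: (eK (\row_i tnth y i)); last by exists y.
split=> // i j; rewrite !mxE.
have := bxy j Logic.I; rewrite /= tnth_mktuple => cy.
apply: le_ball (ltW ke) _ _; rewrite mulr2n mulrDl mul1r.
exact: ball_triangle (ball_sym (cx j)) cy.
Qed.

(** * Extrema of the cumulative distribution function *)

Section cdf_extrema.
Context d (T : measurableType d) (R : realType) (P : probability T R).
Variable X : {RV P >-> R}.

(** [L] is a half-line. If it contains its supremum, the value there is the largest; otherwise
    closed half-lines inside [L] exhaust it, and continuity from below applies. *)
Lemma distribution_downclosed (L : set R) : has_sup L ->
  (forall x y, x <= y -> L y -> L x) ->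
  distribution P X L = ereal_sup [set cdf X x | x in L].
Proof.
move=> supL dL; have [[l Ll] ubL] := supL.
have mL : measurable L.
  apply: is_interval_measurable => x y Lx Ly z /andP[_ zy].
  exact: dL zy Ly.
have sub x : L x -> `]-oo, x] `<=` L.
  by move=> Lx y /=; rewrite in_itv/= => /dL; exact.
apply/eqP; rewrite eq_le; apply/andP; split; last first.
  apply: ge_ereal_sup => _ [x Lx <-]; apply: le_measure; rewrite ?inE//.
  exact: sub.
have [Ls|Ls] := pselect (L (sup L)).
  apply: ereal_sup_ubound; exists (sup L) => //; congr (distribution P X _).
  apply/seteqP; split; first exact: sub.
  by move=> x Lx /=; rewrite in_itv/=; exact: sup_upper_bound.
pose A (k : nat) := [set` `]-oo, sup L - k.+1%:R^-1]].
have LA k : L (sup L - k.+1%:R^-1).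
  have [|e Le /ltW] := @sup_adherent _ L k.+1%:R^-1 _ supL; first by rewrite invr_gt0.
  by move/dL; exact.
have LE : L = \bigcup_k A k.
  apply/seteqP; split=> [x Lx|x [k _]]; last exact: sub.
  have xs : 0 < sup L - x.
    rewrite subr_gt0 lt_neqAle sup_upper_bound// andbT.
    by apply/eqP => xs; apply: Ls; rewrite -xs.
  have [k _ /(_ k (leqnn k)) /= ke] := near_infty_natSinv_lt (PosNum xs).
  by exists k => //; rewrite /A/= in_itv/= lerBrDr addrC -lerBrDr ltW.
have : distribution P X \o A @ \oo --> distribution P X L.
  rewrite [in X in _ --> X]LE; apply: nondecreasing_cvg_mu => //.
  - by move=> i; exact: measurable_itv.
  - by rewrite -LE.
  - move=> i j ij; apply/subsetPset; apply: subset_itvl.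
    by rewrite bnd_simp lerD2l lerN2 lef_pV2 ?posrE// ler_nat.
apply: cvge_le; apply: nearW => k.
by apply: ereal_sup_ubound; exists (sup L - k.+1%:R^-1).
Qed.

(** The lower bounds of [S] form the closed half-line ending at [inf S]; right continuity makes the
    cdf there the limit of its values on [S]. *)
Lemma distribution_upclosed_lbound (S : set R) : has_inf S ->
  (forall x y, x <= y -> S x -> S y) ->
  distribution P X (lbound S) = ereal_inf [set cdf X x | x in S].
Proof.
move=> infS uS; have [[s Ss] lbS] := infS.
have -> : lbound S = `]-oo, inf S]%classic.
  apply/seteqP; split=> x /=; rewrite in_itv/=.
    by move=> Sx; apply: lb_le_inf => //; exists s.
  by move=> xS y Sy; rewrite (le_trans xS)// ge_inf.
apply/eqP; rewrite eq_le; apply/andP; split.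
  apply: le_ereal_inf_tmp => _ [x Sx <-]; apply: cdf_nondecreasing.
  exact: ge_inf.
apply: (cvge_ge _ (@cdf_right_continuous _ _ _ _ X (inf S))).
near=> x; apply: ereal_inf_lbound; exists x => //.
have xS : inf S < x by near: x; exact: nbhs_right_gt.
have [|y Sy] := @inf_adherent _ S (x - inf S) _ infS; first by rewrite subr_gt0.
by rewrite addrC subrK => /ltW /uS; exact.
Unshelve. all: by end_near. Qed.

(** The limit 0 at minus infinity gives a member, the limit 1 at plus infinity an upper bound. *)
Lemma has_sup_cdf_lt (c : R) : 0 < c < 1 ->
  has_sup [set x | (cdf X x < c%:E)%E].
Proof.
move=> /andP[c0 c1]; split.
  have := @cvg_cdfNy0 _ _ _ P X [set y | (y < c%:E)%E].
  case; first by apply: open_ereal_lt'; rewrite lte_fin.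
  by move=> M [_ MF]; exists (M - 1); apply: MF; rewrite ltrBlDr ltrDl.
have := @cvg_cdfy1 _ _ _ P X [set y | (c%:E < y)%E].
case; first by apply: open_ereal_gt'; rewrite lte_fin.
move=> M [_ MF]; exists (M + 1) => x /= xc; rewrite leNgt; apply/negP => Mx.
suff : (c%:E < c%:E)%E by rewrite ltxx.
by apply: lt_trans xc; apply: MF; apply: lt_trans Mx; rewrite ltrDl.
Qed.

Lemma has_inf_cdf_gt (c : R) : 0 < c < 1 ->
  has_inf [set x | (c%:E < cdf X x)%E].
Proof.
move=> /andP[c0 c1]; split.
  have := @cvg_cdfy1 _ _ _ P X [set y | (c%:E < y)%E].
  case; first by apply: open_ereal_gt'; rewrite lte_fin.
  by move=> M [_ MF]; exists (M + 1); apply: MF; rewrite ltrDl.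
have := @cvg_cdfNy0 _ _ _ P X [set y | (y < c%:E)%E].
case; first by apply: open_ereal_lt'; rewrite lte_fin.
move=> M [_ MF]; exists (M - 1) => x /= xc; rewrite leNgt; apply/negP => Mx.
suff : (c%:E < c%:E)%E by rewrite ltxx.
by apply: (lt_trans xc); apply: MF; apply: (lt_trans Mx); rewrite ltrBlDr ltrDl.
Qed.

(** The left limit of the cdf at [x] is its supremum over the points below [x], so it exceeds [c]
    exactly when the cdf does at some such point. *)
Lemma distribution_itvNyo_le (c x : R) :
  (distribution P X `]-oo, x[ <= c%:E)%E <->
  lbound [set y | (c%:E < cdf X y)%E] x.
Proof.
split=> [Fx y /= cy|lx].
  rewrite leNgt; apply/negP => yx.
  suff : (c%:E < c%:E)%E by rewrite ltxx.
  apply: (lt_le_trans cy); apply: le_trans Fx.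
  apply: le_measure; rewrite ?inE//; apply: subset_itvl.
  by rewrite bnd_simp.
have supx : has_sup `]-oo, x[.
  split; first by exists (x - 1); rewrite /= in_itv/= ltrBlDr ltrDl.
  by exists x => y; rewrite /= in_itv/= => /ltW.
rewrite distribution_downclosed//.
  apply: ge_ereal_sup => v [y /=]; rewrite in_itv/= => yx <-.
  by rewrite leNgt; apply/negP => /lx; rewrite leNgt yx.
by move=> y z yz /=; rewrite !in_itv/=; exact: le_lt_trans.
Qed.

End cdf_extrema.

(** * Law of an order statistic on down-closed sets *)

Lemma order_stat_event (T : Type) (R : realType)
    (N n : nat) (Y : 'I_N -> T -> R) (L : set R) :
  (forall x y, x <= y -> L y -> L x) -> (1 <= n <= N)%N ->
  [set w | L (order_stat (fun j => Y j w) n)] =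
  [set w | (n <= #|[pred i | w \in Y i @^-1` L]|)%N].
Proof.
move=> dL nN; apply/funext => w; apply/propext => /=.
rewrite -(@order_stat_downclosed R N n (fun j => Y j w) (fun x => x \in L)) //.
  by split; [exact: mem_set|exact: set_mem].
by move=> x y xy /set_mem Ly; apply/mem_set/(dL _ _ xy).
Qed.

Lemma order_stat_probability (R : realType) (d : nat)
    (Q : set (d.-tuple R)) (u : d.-tuple R -> R)
    (d0 : measure_display) (T0 : measurableType d0) (P0 : probability T0 R)
    (q : {RV P0 >-> d.-tuple R})
    (d1 : measure_display) (T : measurableType d1) (P : probability T R)
    (N : nat) (qs : 'I_N -> {RV P >-> d.-tuple R}) (n : nat) (L : set R) :
  measurable Q -> (forall w, Q (q w)) -> measurable_fun Q u ->
  (forall i w, Q (qs i w)) -> (forall i, same_distribution (qs i) q) ->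
  mutually_independent qs -> (1 <= n <= N)%N ->
  measurable L -> (forall x y, x <= y -> L y -> L x) ->
  measurable [set w | L (order_stat (fun j => u (qs j w)) n)] /\
  P [set w | L (order_stat (fun j => u (qs j w)) n)] =
  (binomial_tail R N n).[fine (P0 ((u \o q) @^-1` L))]%:E.
Proof.
move=> mQ Qq mu Qqs sd ind nN mL dL.
(* As [u] is measurable on [Q] only, preimages are cut down to [Q], which changes nothing for
   variables with values in [Q]. *)
have mB B : measurable B -> measurable (Q `&` u @^-1` B) by move=> mB; exact: mu.
have qsE i B : (u \o qs i) @^-1` B = qs i @^-1` (Q `&` u @^-1` B).
  by apply/seteqP; split=> w //= [].
have qE B : (u \o q) @^-1` B = q @^-1` (Q `&` u @^-1` B).
  by apply/seteqP; split=> w //= [].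
have mX B : measurable B -> measurable ((u \o q) @^-1` B).
  by move=> ?; rewrite qE; apply: measurable_funPTI; exact: mB.
have mY i B : measurable B -> measurable ((u \o qs i) @^-1` B).
  by move=> ?; rewrite qsE; apply: measurable_funPTI; exact: mB.
have PY i B : measurable B -> P ((u \o qs i) @^-1` B) = P0 ((u \o q) @^-1` B).
  by move=> ?; rewrite qsE qE; apply: (sd i); exact: mB.
rewrite (order_stat_event (fun j => u \o qs j) dL nN); split.
  by apply: measurable_count_ge => i; exact: mY.
apply: probability_count_ge => [i|J]; first exact: mY.
have pfin : P0 ((u \o q) @^-1` L) \is a fin_num.
  by apply: fin_num_measure; exact: mX.
(* Choosing [L] or its complement for each sample makes independence over all indices give the
   probability of one pattern of successes. *)
pose B (i : 'I_N) := if i \in J then L else ~` L.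
have mBi i : measurable (B i).
  by rewrite /B; case: ifP => // _; exact: measurableC.
have := ind [set: 'I_N]%SET (fun i => Q `&` u @^-1` B i) (fun i => mB _ (mBi i)).
rewrite big_mkcond/= => {}ind.
transitivity (P (\bigcap_(i in [set` [set: 'I_N]%SET])
    qs i @^-1` (Q `&` u @^-1` B i))).
  congr (P _); apply/seteqP; split=> w wB i.
    move=> _; rewrite -qsE /B; have := wB i Logic.I.
    by case: ifP.
  move=> _; have := wB i; rewrite /= inE => /(_ isT)[_].
  by rewrite /B; case: ifP.
rewrite ind -prodEFin; apply: eq_bigr => i _.
rewrite inE -qsE PY// /B; case: ifP => _; first by rewrite fineK.
rewrite preimage_setC probability_setC; last exact: mX.
by rewrite EFinB fineK.
Qed.

Lemma binomial_tail_mono (R : realType) (N n : nat) : (1 <= n <= N)%N ->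
  {in `[0, 1]%R &, {mono horner (binomial_tail R N n) : x y / x <= y}}.
Proof. by move=> nN; apply: le_mono_in; exact: binomial_tail_ltr. Qed.

Lemma binomial_tail_inj (R : realType) (N n : nat) : (1 <= n <= N)%N ->
  {in `[0, 1]%R &, injective (horner (binomial_tail R N n))}.
Proof.
move=> nN x y xI yI /eqP.
by rewrite eq_le !binomial_tail_mono// -eq_le => /eqP.
Qed.

(** * Bounds and equality cases *)

Theorem theorem3 (R : realType) (d : nat)
    (Q : set (d.-tuple R)) (u : d.-tuple R -> R)
    (* the probability space of q *)
    (d0 : measure_display) (T0 : measurableType d0) (P0 : probability T0 R)
    (q : {RV P0 >-> d.-tuple R})
    (* the probability space of the samples *)
    (d1 : measure_display) (T : measurableType d1) (P : probability T R)
    (N : nat) (qs : 'I_N -> {RV P >-> d.-tuple R})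
    (n m : nat) (eps : R) :
  (0 < d)%N ->
  compact_tuple Q ->
  (forall w, Q (q w)) ->
  has_density (distribution P0 q) ->
  measurable_fun Q u ->
  (forall i w, Q (qs i w)) ->
  (forall i, same_distribution (qs i) q) ->
  mutually_independent qs ->
  (1 <= n <= N)%N -> (1 <= m <= N)%N ->
  0 < eps < 1 ->
  let F := cdf_fun P0 (u \o q) in
  let uhat (i : nat) (w : T) := order_stat (fun j => u (qs j w)) i in
  let upper :=
    P [set w | (P0 [set w0 | (uhat n w < u (q w0))%R] <= eps%:E)%E] in
  let upper_bound := (1 - \int[lebesgue_measure]_(x in `[0%R, (1 - eps)%R])
    (N`!%:R / (n.-1`!%:R * (N - n)`!%:R) * x ^+ n.-1 * (1 - x) ^+ (N - n))%:E)%E in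
  let lower :=
    P [set w | (P0 [set w0 | (u (q w0) < uhat m w)%R] <= eps%:E)%E] in
  let lower_bound := (1 - \int[lebesgue_measure]_(x in `[0%R, (1 - eps)%R])
    (N`!%:R / (m.-1`!%:R * (N - m)`!%:R) * x ^+ (N - m) * (1 - x) ^+ m.-1)%:E)%E in
  [/\ (upper_bound <= upper)%E,
      upper = upper_bound <->
        ereal_sup [set F x | x in [set x | (F x < (1 - eps)%:E)%E]] = (1 - eps)%:E,
      (lower_bound <= lower)%E &
      lower = lower_bound <->
        ereal_inf [set F x | x in [set x | (eps%:E < F x)%E]] = eps%:E].
Proof.
move=> _ cQ Qq _ mu Qqs sd ind nN mN /andP[e0 e1] F uhat upper upper_bound
  lower lower_bound.
have mQ : measurable Q.
  by apply: closed_rV_measurable; apply: compact_closed => //; exact: norm_hausdorff.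
have qE B : (u \o q) @^-1` B = q @^-1` (Q `&` u @^-1` B).
  by apply/seteqP; split=> w //= [].
have mX : measurable_fun setT (u \o q).
  move=> _ B mB; rewrite setTI qE; apply: measurable_funPTI; exact: mu.
pose X : {RV P0 >-> R} := HB.pack (u \o q) (isMeasurableFun.Build _ _ _ _ _ mX).
have osP k L (kN : (1 <= k <= N)%N) :=
  @order_stat_probability _ _ _ _ _ _ _ _ _ _ _ _ _ k L mQ Qq mu Qqs sd ind kN.
have dist_fin (A : set R) : measurable A ->
    exists2 p, distribution P0 X A = p%:E & p \in `[0, 1]%R.
  move=> mA; have pfin : distribution P0 X A \is a fin_num by exact: fin_num_measure.
  exists (fine (distribution P0 X A)); first by rewrite fineK.
  by rewrite in_itv/= -!lee_fin fineK// measure_ge0 probability_le1.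
have e01 : 0 < 1 - eps < 1 by apply/andP; split; lra.
have eI : eps \in `[0, 1]%R by rewrite in_itv/= !ltW.
have ceI : 1 - eps \in `[0, 1]%R by rewrite in_itv/=; apply/andP; split; lra.
have down_meas (L : set R) : (forall x y, x <= y -> L y -> L x) -> measurable L.
  move=> dL; apply: is_interval_measurable => x y _ Ly z /andP[_ zy].
  exact: dL zy Ly.
pose L := [set x | (cdf X x < (1 - eps)%:E)%E].
have dL x y : x <= y -> L y -> L x.
  by move=> xy; apply: le_lt_trans; exact: cdf_nondecreasing.
pose S := [set x | (eps%:E < cdf X x)%E].
have uS x y : x <= y -> S x -> S y.
  by move=> xy /lt_le_trans; apply; exact: cdf_nondecreasing.
have dS x y : x <= y -> lbound S y -> lbound S x.
  by move=> xy Sy z /Sy; exact: le_trans.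
have supF := distribution_downclosed X (has_sup_cdf_lt X e01) dL.
have infF := distribution_upclosed_lbound X (has_inf_cdf_gt X (introT andP (conj e0 e1))) uS.
(* [p] and [r] are the success probabilities of the two events: the supremum of the cdf over [L] and
   its infimum over [S]. *)
have [p pE pI] := dist_fin _ (down_meas _ dL).
have [r rE rI] := dist_fin _ (down_meas _ dS).
have p_le : p <= 1 - eps.
  by rewrite -lee_fin -pE supF; apply: ge_ereal_sup => _ [x /ltW Lx <-].
have r_ge : eps <= r.
  by rewrite -lee_fin -rE infF; apply: le_ereal_inf_tmp => _ [x /ltW Sx <-].
have upperE : upper = (1 - (binomial_tail R N n).[p])%:E.
  have [mE PE] := osP n L nN (down_meas _ dL) dL.
  (* The inner probability is 1 minus the cdf at [uhat n w], so it is at most [eps] exactly when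
     [uhat n w] is outside [L]. *)
  rewrite /upper (_ : [set w | _] = ~` [set w | L (uhat n w)]).
    by rewrite probability_setC// PE -[P0 _]/(distribution P0 X L) pE.
  have ccdfE y : P0 [set w0 | y < u (q w0)] = (1 - cdf X y)%E.
    rewrite -[cdf X y]/(P0 (X @^-1` `]-oo, y])) -probability_setC.
      by congr (P0 _); apply/seteqP; split=> w /=; rewrite in_itv/= ltNge => /negP.
    exact: measurable_funPTI.
  apply/seteqP; split=> w /=; rewrite ccdfE /L/=;
    have [a aE _] := dist_fin _ (measurable_itv `]-oo, uhat n w]);
    rewrite (aE : cdf X _ = _) -EFinB lee_fin lte_fin.
    by move=> ?; apply/negP; rewrite -leNgt; lra.
  by move=> /negP; rewrite -leNgt => ?; lra.
have upper_boundE : upper_bound = (1 - (binomial_tail R N n).[1 - eps])%:E.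
  by rewrite /upper_bound integral_beta_density//; case/andP: e01.
have lowerE : lower = ((binomial_tail R N m).[r])%:E.
  have [_ PE] := osP m (lbound S) mN (down_meas _ dS) dS.
  rewrite -[r]/(fine r%:E) -rE -PE; congr (P _).
  have ltE y : [set w0 | u (q w0) < y] = X @^-1` `]-oo, y[.
    by apply/seteqP; split=> w /=; rewrite in_itv.
  apply/seteqP; split=> w /=; rewrite ltE.
    exact: (distribution_itvNyo_le X eps (uhat m w)).1.
  exact: (distribution_itvNyo_le X eps (uhat m w)).2.
have lower_boundE : lower_bound = ((binomial_tail R N m).[eps])%:E.
  have /andP[m0 mleN] := mN.
  (* The integrand is the beta density of index [(N - m).+1], so its integral is that tail at
     [1 - eps], and 1 minus it is the tail of index [m] at [eps]. *)
  have mN' : (1 <= (N - m).+1 <= N)%N by lia.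
  rewrite -(binomial_tail_compl _ mleN) EFinB -(integral_beta_density mN'); last first.
    by case/andP: e01.
  rewrite /lower_bound; congr (_ - _)%E; apply: eq_integral => x _.
  have -> : (N - (N - m).+1 = m.-1)%N by lia.
  by rewrite [(_ * m.-1`!%:R)]mulrC.
rewrite upperE upper_boundE lowerE lower_boundE !lee_fin lerD2l lerN2.
rewrite !binomial_tail_mono//; split=> //.
- rewrite -supF pE; split=> [[/addrI/oppr_inj/binomial_tail_inj ->//]|[->]//].
- rewrite -infF rE; split=> [[/binomial_tail_inj ->//]|[->]//].
Qed.
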